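(* Let $q$ be a prime power, let $h,n,k$ be positive integers, let $\mathcal C\subseteq\mathbb F_{q^h}^n$ be a faithful additive code of $\mathbb F_q$-dimension $k$, and let $d^\perp:=d^\perp(\mathcal C)$ be its dual distance. If $3\le d^\perp<\infty$, then $$\operatorname{crit}(\mathcal C)\le k-h(d^\perp-1)+2.$$
   Context: An additive code $\mathcal C\subseteq\mathbb F_{q^h}^n$ is an $\mathbb F_q$-linear subspace. It is faithful if for every $i\in[n]=\{1,\ldots,n\}$ the coordinate map $\varphi_i:\mathcal C\to\mathbb F_{q^h}$, $c\mapsto c_i$, is surjective. Critical exponent: for an $\mathbb F_q$-subspace $\mathcal D\subseteq\mathcal C$ let $\operatorname{supp}(\mathcal D)=\bigcup_{c\in\mathcal D}\{i\in[n]:c_i\neq0\}$; then $\operatorname{crit}(\mathcal C)$ is the minimum of $\dim_{\mathbb F_q}\mathcal D$ over all $\mathbb F_q$-subspaces $\mathcal D\subseteq\mathcal C$ with $\operatorname{supp}(\mathcal D)=[n]$. Dual distance: fix an $\mathbb F_q$-basis of $\mathbb F_{q^h}$ and let $\widetilde{\mathcal C}\subseteq\mathbb F_q^{hn}=(\mathbb F_q^h)^n$ be the image of $\mathcal C$ under the coordinatewise expansion $\mathbb F_{q^h}\to\mathbb F_q^h$ with respect to this basis. Let $\widetilde{\mathcal C}^\perp\subseteq\mathbb F_q^{hn}$ be its dual with respect to the standard inner product. For $x=(x_1,\ldots,x_n)\in(\mathbb F_q^h)^n$ the folded Hamming weight is $\operatorname{wt}_{\rm F}(x)=|\{i\in[n]:x_i\ne0\}|$.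 Then $d^\perp(\mathcal C):=\min\{\operatorname{wt}_{\rm F}(x):0\ne x\in\widetilde{\mathcal C}^\perp\}$, with $d^\perp(\mathcal C)=\infty$ if $\widetilde{\mathcal C}^\perp=0$; this does not depend on the chosen basis. *)

(* Defs.v *)
From HB Require Import structures.
From mathcomp Require Import all_boot all_order all_algebra all_field.
From mathcomp Require Import boolp classical_sets.
Set Implicit Arguments.
Unset Strict Implicit.
Unset Printing Implicit Defensive.
Import Order.TTheory GRing.Theory Num.Theory.
Local Open Scope classical_set_scope.
Local Open Scope ring_scope.

(* Minimum of a set of naturals; [None] stands for infinity (empty set). *)
Definition natmin (P : set nat) : option nat :=
  if pselect (exists m, `[< P m >]) is left exP then Some (ex_minn exP)
  else None.

Lemma natmin_SomeP (P : set nat) (m : nat) :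
  natmin P = Some m <-> P m /\ (forall m', P m' -> (m <= m')%N).
Proof.
rewrite /natmin; case: pselect => [exP|nexP]; last first.
  by split=> // -[Pm _]; case: nexP; exists m; apply/asboolP.
case: ex_minnP => r /asboolP Pr rmin; split=> [[<-]|[Pm mmin]].
  by split=> // m' Pm'; apply/rmin/asboolP.
by congr Some; apply/eqP; rewrite eqn_leq mmin // rmin //; apply/asboolP.
Qed.

Lemma natmin_NoneP (P : set nat) : natmin P = None <-> P = set0.
Proof.
rewrite /natmin; case: pselect => [exP|nexP]; split=> //.
  by have [m /asboolP Pm] := exP; move=> P0; rewrite P0 in Pm.
move=> _; apply/seteqP; split=> // m Pm; case: nexP.
by exists m; apply/asboolP.
Qed.

(* The ambient space [L^n] is [{ffun 'I_n -> L}], the library's vector space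
   over the base field [F] (whereas ['rV[L]_n] is one over [L]); an additive
   code is therefore a term of type [{vspace {ffun 'I_n -> L}}]. *)
Section AdditiveCodes.
Variables (F : finFieldType) (L : fieldExtType F) (n : nat).
Implicit Types C D : {vspace {ffun 'I_n -> L}}.

Definition faithful C : Prop :=
  forall (i : 'I_n) (a : L), exists2 c : {ffun 'I_n -> L}, c \in C & c i = a.

Definition supp D : set 'I_n :=
  \bigcup_(c in [set` D]) [set i | c i != 0].

Definition crit C : option nat :=
  natmin [set m | exists D, [/\ (D <= C)%VS, supp D = [set: 'I_n]
                              & \dim D = m]].

(* [F^(hn) = (F^h)^n] is ['M[F]_(n, h)]: row [i] holds the [F]-coordinates of
   the [i]-th symbol in the basis [e]. *)
Definition expand (h : nat) (e : h.-tuple L) (c : {ffun 'I_n -> L}) :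
  'M[F]_(n, h) := \matrix_(i < n, j < h) coord e j (c i).

Lemma expand_is_linear (h : nat) (e : h.-tuple L) : linear (expand e).
Proof. by move=> a c d; apply/matrixP=> i j; rewrite !(mxE, ffunE) linearP. Qed.

HB.instance Definition _ (h : nat) (e : h.-tuple L) :=
  GRing.isLinear.Build F {ffun 'I_n -> L} 'M[F]_(n, h) _ (expand e)
    (expand_is_linear e).

Definition expanded_code (h : nat) (e : h.-tuple L) C :
  {vspace 'M[F]_(n, h)} := (linfun (expand e) @: C)%VS.

End AdditiveCodes.

Section DualDistance.
Variables (F : finFieldType) (n h : nat).
Implicit Types x y : 'M[F]_(n, h).

Definition inner_product x y : F := \sum_(i < n) \sum_(j < h) x i j * y i j.

Definition dual_code (D : {vspace 'M[F]_(n, h)}) : set 'M[F]_(n, h) :=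
  [set x | forall y, y \in D -> inner_product x y = 0].

Definition folded_wt x : nat := #|[pred i : 'I_n | row i x != 0]|.

End DualDistance.

Definition dual_distance (F : finFieldType) (L : fieldExtType F) (n h : nat)
    (e : h.-tuple L) (C : {vspace {ffun 'I_n -> L}}) : option nat :=
  natmin [set folded_wt x | x in dual_code (expanded_code e C) `\ 0].

(* Main.v *)
(** Let [r = d - 1]. By minimality of [d], any [r] symbols of the code are free.
  Fix a set [T0] of [r] coordinates, let [K] be the subcode vanishing on [T0],
  of dimension [k - h r], and let [S] be the set of coordinates on which [K]
  vanishes. Words of [K] cover the complement of [S]; on [S], any [r] symbols
  determine the others, i.e., the code is MDS there. It thus suffices to cover
  [S] by two words. Write [T0 = a |: (b |: T)]. The words with values 0 on [T],
  1 at [a], and 0 at some [i] in [B = S :\: (a |: T)] have distinct values at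
  [b], so [#|B| <= #|L|]. For words with values 1 on [T] and [u] at [a], each
  [i] in [B] forbids one value at [b]; a suitable [u] makes two of these
  forbidden values equal, leaving an admissible one. The resulting word covers
  all of [S] except possibly [a], and a second word covers [a]. *)

Require Import Defs.
From HB Require Import structures.
From mathcomp Require Import all_boot all_order all_algebra all_field.
From mathcomp Require Import boolp classical_sets.
Set Implicit Arguments.
Unset Strict Implicit.
Unset Printing Implicit Defensive.
Import Order.TTheory GRing.Theory Num.Theory.
Local Open Scope ring_scope.

(** Project off [U] along a complement: some [v] outside [U] survives, and a coordinate that is
    nonzero on its image gives [phi]. *)
Lemma exists_annihilator (F : fieldType) (vT : vectType F) (U : {vspace vT}) :
  U != fullv ->
  exists2 phi : 'Hom(vT, F^o), phi != 0 & forall u, u \in U -> phi u = 0.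
Proof.
move=> U_neq; have [v vNU] : exists v, v \notin U.
  have /subvPn[v _ vNU] : ~~ (fullv <= U)%VS.
    by apply: contra U_neq => fU; rewrite eqEsubv subvf.
  by exists v.
pose w := v - projv U v.
have w_neq0 : w != 0.
  by apply: contra vNU; rewrite subr_eq0 => /eqP->; apply: memv_proj.
have [j wj] : exists j, coord (vbasis fullv) j w != 0.
  apply/existsP; apply: contraR w_neq0; rewrite negb_exists => /forallP w0.
  rewrite (coord_vbasis (memvf w)) big1 // => j _.
  by have := w0 j; rewrite negbK => /eqP->; rewrite scale0r.
pose x := linfun (coord (vbasis fullv) j : vT -> F^o).
pose phi := (x \o (\1 - projv U))%VF.
have phiE u : phi u = coord (vbasis fullv) j (u - projv U u).
  by rewrite comp_lfunE lfunE /= add_lfunE opp_lfunE id_lfunE.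
exists phi => [|u uU]; last by rewrite phiE projv_id // subrr linear0.
by apply: contraNneq wj => phi0; rewrite -phiE phi0 lfunE.
Qed.

(** If [g] took every value on [B], then [#|T| <= #|B|], while [f] gives [#|B| <= #|T|]; so
    [#|B| = #|T| > 1] and [g] would be injective on [B]. *)
Lemma exists_notin_imset (I T : finType) (B : {set I}) (f g : I -> T) :
    {in B &, injective f} -> (0 < #|B|)%N -> (1 < #|T|)%N ->
    ((1 < #|B|)%N -> ~ {in B &, injective g}) ->
  exists v, v \notin [set g i | i in B].
Proof.
move=> f_inj B_gt0 T_gt1 g_ninj; apply/existsP; rewrite -negb_forall.
apply/negP => /forallP all_g.
have T_le : (#|T| <= #|[set g i | i in B]|)%N.
  by rewrite -cardsT; apply/subset_leq_card/fintype.subsetP => v _; apply: all_g.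
have B_le : (#|B| <= #|T|)%N by rewrite -(card_in_imset f_inj) max_card.
have gB := leq_imset_card g B.
apply: g_ninj; first exact: leq_trans T_gt1 (leq_trans T_le gB).
by apply/imset_injP; rewrite eqn_leq gB (leq_trans B_le).
Qed.

Section AdditiveCode.
Variables (F : finFieldType) (L : fieldExtType F) (n : nat).
Implicit Types (C : {vspace {ffun 'I_n -> L}}) (J S T : {set 'I_n}).

Definition restrict J (c : {ffun 'I_n -> L}) : {ffun {i | i \in J} -> L} :=
  [ffun s => c (val s)].

Lemma restrict_is_linear J : linear (restrict J).
Proof. by move=> a c d; apply/ffunP => s; rewrite !ffunE. Qed.

HB.instance Definition _ J :=
  GRing.isLinear.Build F {ffun 'I_n -> L} {ffun {i | i \in J} -> L} _
    (restrict J) (restrict_is_linear J).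

Definition vanishing J : {vspace {ffun 'I_n -> L}} :=
  lker (linfun (restrict J)).

Lemma vanishingP J (c : {ffun 'I_n -> L}) : reflect {in J, forall i, c i = 0} (c \in vanishing J).
Proof.
rewrite memv_ker lfunE /=; apply: (iffP eqP) => [/ffunP c0 i iJ | c0].
  by have := c0 (exist _ i iJ); rewrite !ffunE.
by apply/ffunP => -[i iJ]; rewrite !ffunE /= c0.
Qed.

(** Surjectivity of the restriction to [J], stated with a total [f] to avoid functions on a
    subtype. *)
Definition interpolates C J :=
  forall f : 'I_n -> L, exists2 c, c \in C & {in J, c =1 f}.

(** Rank-nullity for the restriction to [J], which interpolation makes surjective. *)
Lemma dim_vanishing C J : interpolates C J ->
  (\dim (C :&: vanishing J) + #|J| * \dim {:L} = \dim C)%N.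
Proof.
move=> interp; rewrite -(limg_ker_dim (linfun (restrict J)) C); congr addn.
have -> : (linfun (restrict J) @: C = fullv)%VS.
  apply/eqP; rewrite eqEsubv subvf; apply/subvP => g _.
  have [c cC cg] := interp (fun i => if insub i is Some s then g s else 0).
  apply/memv_imgP; exists c => //; rewrite lfunE /=.
  apply/ffunP => -[i iJ]; rewrite ffunE cg //= insubT //=.
by rewrite !dimvf /dim /= card_sig.
Qed.

(** Otherwise a nonzero functional kills both [C] and all words vanishing on [J]; its coordinates
    form a nonzero dual word supported on [J], of folded weight below [d]. *)
Lemma dual_distance_interpolates h (e : h.-tuple L) C d J :
    basis_of {:L} e -> dual_distance e C = Some d -> (#|J| < d)%N ->
  interpolates C J.
Proof.
move=> e_basis /natmin_SomeP[_ d_min] J_lt.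
have [full|/exists_annihilator[phi phi_neq0 phi0]] :=
    eqVneq (C + vanishing J)%VS fullv.
  move=> f; have : [ffun i => f i] \in (C + vanishing J)%VS.
    by rewrite full memvf.
  move=> /memv_addP[c cC [z /vanishingP z0 fE]]; exists c => // i iJ.
  by have /ffunP/(_ i) := fE; rewrite !ffunE z0 // addr0.
pose single i (v : L) : {ffun 'I_n -> L} := [ffun t => if t == i then v else 0].
(* The matrix representing [phi] under [inner_product]: its entries are the values of [phi] on the
   basis words. *)
pose x := (\matrix_(i < n, j < h) (phi (single i e`_j) : F)).
have expansion (c : {ffun 'I_n -> L}) : c = \sum_i \sum_j coord e j (c i) *: single i e`_j.
  apply/ffunP => t; rewrite sum_ffunE (bigD1 t) //= [X in _ + X]big1 ?addr0 => [|i it].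
    rewrite sum_ffunE {1}(coord_basis e_basis (memvf (c t))).
    by apply: eq_bigr => j _; rewrite !ffunE eqxx.
  by rewrite sum_ffunE big1 // => j _; rewrite !ffunE eq_sym (negPf it) scaler0.
have phiE c : phi c = inner_product x (expand e c).
  rewrite {1}(expansion c) linear_sum; apply: eq_bigr => i _.
  rewrite linear_sum; apply: eq_bigr => j _.
  by rewrite linearZ /= !mxE mulrC.
have : (d <= folded_wt x)%N.
  apply: d_min; exists x => //; split=> [y /memv_imgP[c cC ->]|/= x0].
    by rewrite lfunE /= -phiE phi0 // (subvP (addvSl _ _)).
  case/eqP: phi_neq0; apply/lfunP => c; rewrite phiE x0 lfunE /=.
  rewrite /inner_product big1 // => i _; rewrite big1 // => j _.
  by rewrite mxE mul0r.
rewrite leqNgt; case/negP; apply: leq_ltn_trans J_lt.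
apply/subset_leq_card/fintype.subsetP => i; rewrite inE; apply: contraR => iNJ.
apply/eqP/rowP => j; rewrite !mxE phi0 //.
apply: (subvP (addvSr _ _)); apply/vanishingP => t tJ.
by rewrite ffunE; case: eqP => // ti; rewrite -ti tJ in iNJ.
Qed.

(* On [S] the code is MDS: any [#|T| + 2] symbols are free and determine the
   others. *)
Lemma two_words_cover C S T a b :
    a \in S -> b \in S -> T \subset S -> a \notin T -> b \notin T -> a != b ->
    (forall J, #|J| = #|T|.+2 -> interpolates C J) ->
    (forall J (c : {ffun 'I_n -> L}), J \subset S -> #|J| = #|T|.+2 -> c \in C ->
       {in J, forall i, c i = 0} -> {in S, forall i, c i = 0}) ->
  exists c1 c2, [/\ c1 \in C, c2 \in C &
    {in S, forall i, (c1 i != 0) || (c2 i != 0)}].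
Proof.
move=> aS bS TS aT bT ab interp det.
have cardJ i j : i \notin T -> j \notin T -> i != j -> #|i |: (j |: T)| = #|T|.+2.
  by move=> iT jT ij; rewrite !cardsU1 !inE negb_or ij iT jT.
have word i j u v t : i \notin T -> j \notin T -> i != j ->
    exists c, [/\ c \in C, c i = u, c j = v & {in T, forall l, c l = t}].
  move=> iT jT ij.
  have [c cC cE] := interp _ (cardJ i j iT jT ij)
    (fun l => if l == i then u else if l == j then v else t).
  exists c; split=> // [||l lT].
  - by rewrite cE ?eqxx // !inE eqxx.
  - by rewrite cE ?eqxx 1?eq_sym ?(negPf ij) // !inE eqxx orbT.
  rewrite cE ?inE ?lT ?orbT //; case: eqP => [li|_].
    by rewrite -li lT in iT.
  by case: eqP => // lj; rewrite -lj lT in jT.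
(* The difference of [c] and [c'] vanishes at [i], at [j] and on [T], that is, on [#|T| + 2]
   positions, so [det] makes it vanish on [S]. *)
have agree i j c c' t : i \in S -> j \in S -> i \notin T -> j \notin T ->
    i != j -> c \in C -> c' \in C -> c i = c' i -> c j = c' j ->
    {in T, forall l, c l = t} -> {in T, forall l, c' l = t} -> {in S, c =1 c'}.
  move=> iS jS iT jT ij cC c'C ci cj cT c'T l lS; apply/eqP; rewrite -subr_eq0.
  have JS : i |: (j |: T) \subset S by rewrite !finset.subUset !finset.sub1set iS jS.
  have := det _ (c - c') JS (cardJ i j iT jT ij) (memvB cC c'C) _ l lS.
  rewrite !ffunE => -> // m; rewrite !inE !ffunE => /or3P[/eqP->|/eqP->|mT].
  - by rewrite ci subrr.
  - by rewrite cj subrr.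
  by rewrite cT // c'T // subrr.
pose B := S :\: (a |: T).
have inB i : i \in B -> [/\ i \in S, i \notin T & a != i].
  by rewrite !inE negb_or eq_sym => /andP[/andP[-> ->] ->].
have bB : b \in B by rewrite !inE negb_or bS bT eq_sym ab.
have /fin_all_exists[w wP] i : exists c, i \in B ->
    [/\ c \in C, c a = 1, c i = 0 & {in T, forall l, c l = 0}].
  have [iB|_] := boolP (i \in B); last by exists 0.
  have [iS iT ai] := inB i iB.
  by have [c cP] := word a i 1 0 0 aT iT ai; exists c.
(* If [w i] and [w j] also agreed at [b], they would agree on [S], so [w i]
   would vanish at [i], at [j] and on [T], against [w i a = 1]. *)
have w_inj : {in B &, injective (fun i => w i b : finvect_type L)}.
  move=> i j iB jB /= wij; apply/eqP; apply/idPn => ij.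
  have [iS iT ai] := inB i iB; have [jS jT aj] := inB j jB.
  have [wiC wia wii wiT] := wP i iB; have [wjC wja wjj wjT] := wP j jB.
  have wiwj := agree a b _ _ 0 aS bS aT bT ab wiC wjC
    (etrans wia (esym wja)) wij wiT wjT.
  have wi0 : {in S, w i =1 (0 : {ffun 'I_n -> L})}.
    apply: (agree i j _ _ 0) => //; rewrite ?mem0v ?ffunE //.
      by rewrite wiwj.
    by move=> l _; rewrite ffunE.
  by have := wi0 a aS; rewrite wia ffunE => /eqP; rewrite oner_eq0.
(* This choice of the value [u] at [a] makes the words [y i] and [y j] below
   coincide on [S], so the values [y i b] do not exhaust [L]. *)
have [u uP] : exists u, (1 < #|B|)%N -> exists i j z, [/\ i \in B, j \in B, i != j &
    [/\ z \in C, z i = 0, z j = 0, z a = u & {in T, forall l, z l = 1}]].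
  have [/card_gt1P[i [j [iB jB ij]]]|_] := boolP (1 < #|B|)%N; last by exists 0.
  have [_ iT _] := inB i iB; have [_ jT _] := inB j jB.
  have [z [zC zi zj zT]] := word i j 0 0 1 iT jT ij.
  by exists (z a) => _; exists i, j, z.
have /fin_all_exists[y yP] i : exists c, i \in B ->
    [/\ c \in C, c a = u, c i = 0 & {in T, forall l, c l = 1}].
  have [iB|_] := boolP (i \in B); last by exists 0.
  have [iS iT ai] := inB i iB.
  by have [c cP] := word a i u 0 1 aT iT ai; exists c.
(* [v] will be the value of [c1] at [b]; [finvect_type L] gives [L] the finite type structure needed
   for counting. *)
have [v vNy] : exists v, v \notin [set (y i b : finvect_type L) | i in B].
  apply: (exists_notin_imset w_inj); first by apply/card_gt0P; exists b.
    by apply/card_gt1P; exists 0, 1; rewrite !inE eq_sym oner_eq0.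
  move=> /uP[i [j [z [iB jB ij [zC zi zj za zT]]]]] y_inj.
  have [iS iT ai] := inB i iB; have [jS jT aj] := inB j jB.
  have [yiC yia yii yiT] := yP i iB; have [yjC yja yjj yjT] := yP j jB.
  have yiz := agree a i _ _ 1 aS iS aT iT ai yiC zC
    (etrans yia (esym za)) (etrans yii (esym zi)) yiT zT.
  have yjz := agree a j _ _ 1 aS jS aT jT aj yjC zC
    (etrans yja (esym za)) (etrans yjj (esym zj)) yjT zT.
  by case/eqP: ij; apply: y_inj => //=; rewrite yiz // yjz.
have [c1 [c1C c1a c1b c1T]] := word a b u v 1 aT bT ab.
have [c2 [c2C c2a _ _]] := word a b 1 0 0 aT bT ab.
exists c1, c2; split=> // i iS.
have [->|ia] := eqVneq i a; first by rewrite c2a oner_eq0 orbT.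
have [iT|iT] := boolP (i \in T); first by rewrite c1T // oner_eq0.
have iB : i \in B by rewrite !inE negb_or ia iT.
have [yiC yia yii yiT] := yP i iB.
(* A zero of [c1] at [i] would make [c1] agree with [y i] on [S], in particular at [b], where [v]
   avoids [y i b]. *)
apply/orP; left; apply: contra vNy => /eqP c1i.
have c1y := agree a i _ _ 1 aS iS aT iT _ c1C yiC
    (etrans c1a (esym yia)) (etrans c1i (esym yii)) c1T yiT.
by apply/imsetP; exists i; rewrite // -c1b c1y // eq_sym.
Qed.

Lemma supp_fullP C :
  supp C = [set: 'I_n]%classic <-> forall i, exists2 c, c \in C & c i != 0.
Proof.
split=> [suppC i|cover].
  have : supp C i by rewrite suppC.
  by case=> c cC ci; exists c.
by apply/seteqP; split=> // i _; have [c cC ci] := cover i; exists c.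
Qed.

Lemma crit_le C D m : (D <= C)%VS -> (forall i, exists2 c, c \in D & c i != 0) ->
  (\dim D <= m)%N -> exists2 c, crit C = Some c & (c <= m)%N.
Proof.
move=> DC /supp_fullP suppD Dm; case critC: (crit C) => [c|].
  exists c => //; have /natmin_SomeP[_ c_min] := critC.
  by apply: leq_trans Dm; apply: c_min; exists D.
have /natmin_NoneP/seteqP[+ _] := critC.
by move=> /(_ (\dim D))[]; exists D.
Qed.

(** The subcode vanishing on [a |: (b |: T)] covers all coordinates outside [S]; the two words
    covering [S] add at most 2 to the dimension. *)
Lemma crit_le_vanishing C T a b :
    a \notin T -> b \notin T -> a != b ->
    (forall J, (#|J| <= #|T|.+2)%N -> interpolates C J) ->
  exists2 c, crit C = Some c &
    (c <= \dim (C :&: vanishing (a |: (b |: T))) + 2)%N.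
Proof.
move=> aT bT ab interp; set T0 := a |: (b |: T).
have cT0 : #|T0| = #|T|.+2 by rewrite !cardsU1 !inE negb_or ab aT bT.
set K := (C :&: vanishing T0)%VS.
pose S := [set i | (K <= vanishing [set i])%VS].
have KS i c : i \in S -> c \in K -> c i = 0.
  by rewrite inE => /subvP KS /KS/vanishingP-> //; rewrite inE.
have T0S : T0 \subset S.
  apply/fintype.subsetP => i iT0; rewrite inE; apply/subvP => c.
  rewrite memv_cap => /andP[_ /vanishingP c0].
  by apply/vanishingP => j; rewrite inE => /eqP->; apply: c0.
have [|||||c1 [c2 [c1C c2C cover]]] := @two_words_cover C S T a b _ _ _ aT bT ab.
- by apply: (fintype.subsetP T0S); rewrite !inE eqxx.
- by apply: (fintype.subsetP T0S); rewrite !inE eqxx orbT.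
- by apply: fintype.subset_trans T0S; rewrite /T0 finset.setUA finset.subsetUr.
- by move=> J cJ; apply: interp; rewrite cJ.
- move=> J c JS cJ cC cJ0 i iS; apply: (KS) => //.
  (* As [J] lies in [S], [K] is contained in the subcode vanishing on [J]. Both impose [#|T| + 2]
     free symbols, hence have equal dimension and coincide. *)
  suff <- : (C :&: vanishing J = K)%VS.
    by rewrite memv_cap cC; apply/vanishingP.
  apply/esym/eqP; rewrite eqEdim subv_cap capvSl /=; apply/andP; split.
    by apply/subvP => z zK; apply/vanishingP => j /(fintype.subsetP JS)/KS; apply.
  rewrite -(leq_add2r (#|T|.+2 * \dim {:L})) -{1}cJ -cT0.
  by rewrite !dim_vanishing //; apply: interp; rewrite ?cT0 ?cJ.
apply: (@crit_le C (K + (<[c1]> + <[c2]>))%VS).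
- by rewrite !subv_add capvSl -!memvE c1C.
- move=> i; have [/cover/orP[ci|ci]|] := boolP (i \in S).
  + exists c1 => //; apply: (subvP (addvSr _ _)).
    by apply: (subvP (addvSl _ _)); apply: memv_line.
  + exists c2 => //; apply: (subvP (addvSr _ _)).
    by apply: (subvP (addvSr _ _)); apply: memv_line.
  rewrite inE => /subvPn[c cK ci]; exists c; first exact: (subvP (addvSl _ _)).
  by apply: contra ci => /eqP ci; apply/vanishingP => j; rewrite inE => /eqP->.
apply: leq_trans (dimv_add_leqif _ _) _; rewrite leq_add2l.
apply: leq_trans (dimv_add_leqif _ _) _.
by rewrite !dim_vline (leq_add (leq_b1 _) (leq_b1 _)).
Qed.

End AdditiveCode.

Theorem theorem3p17 (q h n k : nat) (F : finFieldType) (L : fieldExtType F)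
    (cardF : #|F| = q) (dimL : \dim {:L} = h)
    (h_gt0 : (0 < h)%N) (n_gt0 : (0 < n)%N) (k_gt0 : (0 < k)%N)
    (e : h.-tuple L) (e_basis : basis_of {:L} e)
    (C : {vspace {ffun 'I_n -> L}}) (C_faithful : faithful C)
    (dimC : \dim C = k)
    (d : nat) (dual_dist : dual_distance e C = Some d) (d_ge3 : (3 <= d)%N) :
  exists2 c : nat, crit C = Some c &
    c%:Z <= k%:Z - h%:Z * (d%:Z - 1) + 2.
Proof.
(* A folded weight is at most [n], which leaves room for [d - 1] distinct coordinates. *)
have d_le_n : (d <= n)%N.
  have /natmin_SomeP[[x _ <-] _] := dual_dist.
  by apply: leq_trans (max_card _) _; rewrite card_ord.
have interp (J : {set 'I_n}) : (#|J| < d)%N -> interpolates C J.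
  exact: dual_distance_interpolates e_basis dual_dist.
(* Now [d = r + 3]: the [r] coordinates of [T] together with [a] and [b] number [d - 1]. *)
case: d => [|[|[|r]]] // in d_ge3 d_le_n dual_dist interp *.
have r_lt_n : (r < n)%N by apply: leq_trans d_le_n; rewrite ltnS leqW.
have r1_lt_n : (r.+1 < n)%N by apply: leq_trans d_le_n.
pose a := Ordinal r_lt_n; pose b := Ordinal r1_lt_n.
pose T := [set i : 'I_n | (i < r)%N].
have aT : a \notin T by rewrite inE ltnn.
have bT : b \notin T by rewrite inE ltnNge leqnSn.
have ab : a != b by rewrite -val_eqE neq_ltn ltnSn.
have cardT : #|T| = r.
  have widen_inj : injective (widen_ord (ltnW r_lt_n)).
    by move=> i j /(congr1 val) /= /val_inj.
  rewrite -[RHS]card_ord -(card_imset _ widen_inj).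
  apply: eq_card => i; rewrite inE; apply/idP/imsetP => [ir|[j _ ->]] //=.
  by exists (Ordinal ir) => //; apply/val_inj.
have [J|c critC c_le] := @crit_le_vanishing _ _ _ C T a b aT bT ab.
  by rewrite cardT => Jr; apply: interp.
exists c => //.
have cardT0 : #|a |: (b |: T)| = r.+2.
  by rewrite !cardsU1 !inE negb_or ab ltnn ltnNge leqnSn cardT.
have := dim_vanishing (interp (a |: (b |: T)) _); rewrite cardT0 dimL dimC => <- //.
(* With [k] expanded by [dim_vanishing], the term [h * (d - 1)] cancels and [c_le] remains. *)
by rewrite -predn_int // -PoszM mulnC PoszD addrK -PoszD lez_nat.
Qed.
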